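(* Let $n\geq 1$, let $N_1,\ldots,N_n$ be fuzzy negations with $N_1\leq\cdots\leq N_n$ (pointwise), and let $\psi:[0,1]\to[0,1]$ be an automorphism. Then $$\left(\widetilde{N_1\ldots N_n}\right)^{\widetilde{\psi}}=\widetilde{N_1^{\psi}\ldots N_n^{\psi}}.$$
   Context: $L_n([0,1])=\{(x_1,\ldots,x_n)\in[0,1]^n : x_1\leq\cdots\leq x_n\}$, with projections $\pi_i(x_1,\ldots,x_n)=x_i$. A fuzzy negation is a function $N:[0,1]\to[0,1]$ with $N(0)=1$, $N(1)=0$ and $N(x)\geq N(y)$ whenever $x\leq y$. For fuzzy negations $N_1\leq\cdots\leq N_n$, $\widetilde{N_1\ldots N_n}:L_n([0,1])\to L_n([0,1])$ is given by $\widetilde{N_1\ldots N_n}(\mathbf{x})=(N_1(\pi_n(\mathbf{x})),\ldots,N_n(\pi_1(\mathbf{x})))$, i.e. the $i$-th component is $N_i(\pi_{n-i+1}(\mathbf{x}))$. An automorphism of $[0,1]$ is an increasing bijection $\psi:[0,1]\to[0,1]$. The conjugate of $N$ is $N^{\psi}=\psi^{-1}\circ N\circ\psi$. The map $\widetilde{\psi}:L_n([0,1])\to L_n([0,1])$ is $\widetilde{\psi}(\mathbf{x})=(\psi(\pi_1(\mathbf{x})),\ldots,\psi(\pi_n(\mathbf{x})))$, and for $\mathcal{N}:L_n([0,1])\to L_n([0,1])$, $\mathcal{N}^{\widetilde{\psi}}=\widetilde{\psi}^{-1}\circ\mathcal{N}\circ\widetilde{\psi}$. *)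

(* Defs.v *)
From HB Require Import structures.
From mathcomp Require Import all_boot all_order all_algebra.
From mathcomp Require Import interval_inference.
From mathcomp Require Import boolp classical_sets functions reals.

Set Implicit Arguments.
Unset Strict Implicit.
Unset Printing Implicit Defensive.

Import Order.TTheory GRing.Theory Num.Theory.
Local Open Scope ring_scope.
Local Open Scope order_scope.

(* [pi_(i.+1) x] is [tnth x i]: components are indexed from 0. *)
Record Ln (R : realType) (n : nat) := MkLn {
  Ln_tuple :> n.-tuple {i01 R};
  Ln_sorted : sorted <=%O Ln_tuple }.

HB.instance Definition _ (R : realType) (n : nat) :=
  [isSub for @Ln_tuple R n].
HB.instance Definition _ (R : realType) (n : nat) :=
  [Choice of Ln R n by <:].

Record fuzzy_negation (R : realType) := FuzzyNegation {
  fneg_fun :> {i01 R} -> {i01 R};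
  fneg0 : fneg_fun 0%:i01 = 1%:i01;
  fneg1 : fneg_fun 1%:i01 = 0%:i01;
  fneg_antitone : forall x y, x <= y -> fneg_fun y <= fneg_fun x }.

Definition le_fneg (R : realType) (N M : fuzzy_negation R) : Prop :=
  forall x, N x <= M x.

Definition fneg_chain (R : realType) (n : nat)
    (N : 'I_n -> fuzzy_negation R) : Prop :=
  forall i j : 'I_n, (i <= j)%N -> le_fneg (N i) (N j).

Record automorphism (R : realType) := Automorphism {
  aut_fun :> {i01 R} -> {i01 R};
  aut_homo : {homo aut_fun : x y / x <= y};
  aut_bij : bijective aut_fun }.

(* [f]^-1 o g o [f]; the library's ['pinv_dflt setT f] is the two-sided inverse
   of f when f is bijective, and the default [id] then plays no role. *)
Definition conjugate (T : choiceType) (f g : T -> T) : T -> T :=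
  'pinv_id [set: T] f \o g \o f.

Lemma bij_pinvK (T : choiceType) (f : T -> T) :
  bijective f -> cancel f ('pinv_id [set: T] f).
Proof.
by move=> /bij_inj fI x; apply: pinvKV; rewrite ?in_setT// => ? ? _ _ /fI.
Qed.

Lemma bij_pinvKV (T : choiceType) (f : T -> T) :
  bijective f -> cancel ('pinv_id [set: T] f) f.
Proof.
by case=> g _ gK x; apply: pinvK; rewrite inE; exists (g x).
Qed.

Section Wellformedness.
Variables (R : realType) (n : nat).
Implicit Types (N : 'I_n -> fuzzy_negation R) (psi : automorphism R).

Lemma Ln_le (x : Ln R n) (i j : 'I_n) : (i <= j)%N -> tnth x i <= tnth x j.
Proof.
move=> ij; rewrite !(tnth_nth 0%:i01).
by apply: (sorted_leq_nth le_trans le_refl _ (Ln_sorted x));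
  rewrite ?inE ?size_tuple.
Qed.

Lemma sorted_mktuple (f : 'I_n -> {i01 R}) :
  (forall i j : 'I_n, (i <= j)%N -> f i <= f j) ->
  sorted <=%O [tuple f i | i < n].
Proof.
move=> fle; apply/(sortedP 0%:i01) => i; rewrite size_tuple => lin.
have := fle (Ordinal (ltnW lin)) (Ordinal lin) (leqnSn i).
by rewrite -[f (Ordinal lin)]tnth_mktuple -[f (Ordinal (ltnW _))]tnth_mktuple
  !(tnth_nth 0%:i01).
Qed.

Lemma Nneg_sorted N (leN : fneg_chain N) (x : Ln R n) :
  sorted <=%O [tuple N i (tnth x (rev_ord i)) | i < n].
Proof.
apply: sorted_mktuple => i j ij; apply: le_trans (leN _ _ ij _) _.
by apply: fneg_antitone; apply: Ln_le; rewrite leq_sub2l.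
Qed.

Lemma Naut_sorted psi (x : Ln R n) :
  sorted <=%O [tuple psi (tnth x i) | i < n].
Proof. by apply: sorted_mktuple => i j ij; apply/aut_homo/Ln_le. Qed.

Lemma aut_can_homo psi (g : {i01 R} -> {i01 R}) :
  cancel g psi -> {homo g : x y / x <= y}.
Proof.
move=> gK x y xy; have [//|gyx] := leP (g x) (g y).
have := aut_homo psi (ltW gyx); rewrite !gK => yx.
by move: gyx; rewrite (@le_anti _ _ x y) ?ltxx// xy yx.
Qed.

Lemma aut_pinv_homo psi : {homo 'pinv_id [set: {i01 R}] psi : x y / x <= y}.
Proof. exact/aut_can_homo/bij_pinvKV/aut_bij. Qed.

Lemma aut0 psi : psi 0%:i01 = 0%:i01.
Proof.
have pK := bij_pinvKV (aut_bij psi).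
apply/le_anti/andP; split; last by rewrite -num_le /=.
by rewrite -[leRHS]pK; apply: aut_homo; rewrite -num_le /=.
Qed.

Lemma aut1 psi : psi 1%:i01 = 1%:i01.
Proof.
have pK := bij_pinvKV (aut_bij psi).
apply/le_anti/andP; split; first by rewrite -num_le /=.
by rewrite -[leLHS]pK; apply: aut_homo; rewrite -num_le /=.
Qed.

End Wellformedness.

Definition Nneg (R : realType) (n : nat) (N : 'I_n -> fuzzy_negation R)
    (leN : fneg_chain N) (x : Ln R n) : Ln R n :=
  MkLn (Nneg_sorted leN x).

Definition Naut (R : realType) (n : nat) (psi : automorphism R)
    (x : Ln R n) : Ln R n :=
  MkLn (Naut_sorted psi x).

Section Conjugates.
Variables (R : realType) (psi : automorphism R).
Implicit Type N : fuzzy_negation R.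

Lemma conj_fneg0 N : conjugate psi N 0%:i01 = 1%:i01.
Proof.
by rewrite /conjugate /= aut0 fneg0 -[X in 'pinv_id _ _ X](aut1 psi)
  (bij_pinvK (aut_bij psi)).
Qed.

Lemma conj_fneg1 N : conjugate psi N 1%:i01 = 0%:i01.
Proof.
by rewrite /conjugate /= aut1 fneg1 -[X in 'pinv_id _ _ X](aut0 psi)
  (bij_pinvK (aut_bij psi)).
Qed.

Lemma conj_fneg_antitone N x y :
  x <= y -> conjugate psi N y <= conjugate psi N x.
Proof. by move=> xy; apply/aut_pinv_homo/fneg_antitone/aut_homo. Qed.

Definition conj_fneg N : fuzzy_negation R :=
  FuzzyNegation (conj_fneg0 N) (conj_fneg1 N) (@conj_fneg_antitone N).

Lemma conj_fneg_chain (n : nat) (N : 'I_n -> fuzzy_negation R) :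
  fneg_chain N -> fneg_chain (fun i => conj_fneg (N i)).
Proof. by move=> leN i j ij x; apply/aut_pinv_homo/leN. Qed.

(* Ensures that ['pinv_id setT (Naut psi)] is a genuine inverse. *)
Lemma Naut_bij (n : nat) : bijective (@Naut R n psi).
Proof.
case: (aut_bij psi) => g gK Kg.
have ghomo := aut_can_homo Kg.
exists (@Naut R n (Automorphism ghomo (Bijective Kg gK))) => x;
  by apply/val_inj/eq_from_tnth => i; rewrite !tnth_mktuple /= ?gK ?Kg.
Qed.

End Conjugates.

(* Main.v *)
Require Import Defs.
From mathcomp Require Import all_boot all_order all_algebra.
From mathcomp Require Import reals.
From mathcomp Require Import interval_inference boolp.

(** Applying the bijection [Naut psi] to both sides cancels the outer inverse on the left and, as it
    acts by [psi] on each component, the inverse of [psi] in every conjugated negation on the right.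
    Both sides then have components [N i (psi (tnth x (rev_ord i)))]. *)

Theorem proposition34 (R : realType) (n : nat) (n_ge1 : (1 <= n)%N)
    (N : 'I_n -> fuzzy_negation R) (leN : fneg_chain N)
    (psi : automorphism R) :
  conjugate (Naut psi) (Nneg leN) = Nneg (conj_fneg_chain psi leN).
Proof.
(* The inverse of [Naut psi] comes with no componentwise formula, so it is cancelled rather than
   computed. *)
apply/funext => x; apply: (bij_inj (Naut_bij psi n)).
rewrite /conjugate /= (bij_pinvKV (Naut_bij psi n)).
apply/val_inj/eq_from_tnth => i.
by rewrite !tnth_mktuple /= /conjugate /= (bij_pinvKV (aut_bij psi)).
Qed.
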